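(* Let $(X_n,Y_n)_{n\ge 1}$ follow the Langlie procedure with underlying sensitivity distribution function $F$ and initial parameters $a<b$. Then for every $q\in(0,1)$ such that $\xi_{100q}=F^{-1}(q)$ satisfies $a<\xi_{100q}<b$, we have $$\mathbb{P}\left(X_n\to\xi_{100q}\ \text{as}\ n\to\infty\right)=0.$$
   Context: Sensitivity distribution: $F:\mathbb{R}\to[0,1]$ is a (cumulative) distribution function, and $F^{-1}$ denotes its inverse on $(0,1)$: for each $q\in(0,1)$, $\xi_{100q}=F^{-1}(q)$ is the unique real number with $F(\xi_{100q})=q$. Langlie procedure with parameters $a<b$ (real numbers) and underlying distribution function $F$: this is a sequence of random variables $(X_n,Y_n)_{n\ge1}$ on a probability space, with $X_n$ real-valued (the inputs) and $Y_n\in\{-1,+1\}$ (the outcomes; $+1$ is success, $-1$ is failure), defined inductively as follows. (1) The first input is $X_1=(a+b)/2$. (2) Given the past and the current input, the outcome is $+1$ with probability $F(X_n)$: for all $n\ge1$, $\mathbb{P}(Y_n=+1\mid X_1,Y_1,\dots,X_{n-1},Y_{n-1},X_n)=F(X_n)$ and $\mathbb{P}(Y_n=-1\mid X_1,Y_1,\dots,X_{n-1},Y_{n-1},X_n)=1-F(X_n)$. (3) After $n$ trials, for $i\in\{1,\dots,n-1\}$ say there is balance at index $i$ if $\{Y_{i+1},\dots,Y_n\}$ contains equally many successes and failures, i.e. $\#\{j\in\{i+1,\dots,n\}:Y_j=-1\}=\#\{j\in\{i+1,\dots,n\}:Y_j=+1\}$. Let $\tau_n$ be the largest $i\in\{1,\dots,n-1\}$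 at which there is balance, and $\tau_n=0$ if there is no such $i$. (4) The next input is $$X_{n+1}=\begin{cases}(X_{\tau_n}+X_n)/2 & \text{if }\tau_n>0,\\ (a+X_n)/2 & \text{if }\tau_n=0\text{ and }Y_n=+1,\\ (X_n+b)/2 & \text{if }\tau_n=0\text{ and }Y_n=-1.\end{cases}$$ *)

(* Defs.v *)
From HB Require Import structures.
From mathcomp Require Import all_boot all_order all_algebra.
From mathcomp Require Import all_classical all_reals all_analysis.
Set Implicit Arguments.
Unset Strict Implicit.
Unset Printing Implicit Defensive.
Import Order.TTheory GRing.Theory Num.Theory.
Import numFieldNormedType.Exports.
Local Open Scope classical_set_scope.
Local Open Scope ring_scope.

(* F^-1 on (0,1) is a genuine inverse: every level is attained exactly once.
   F may still take the values 0 and 1 on half-lines. *)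
Definition invertible01 (R : realType) (F : R -> R) : Prop :=
  forall q : R, 0 < q < 1 -> exists! x : R, F x = q.

(* The default value 0 is irrelevant for q in (0,1) when [invertible01 F]. *)
Definition quantile (R : realType) (F : R -> R) (q : R) : R :=
  xget 0 [set x : R | F x = q].

(* Z is a version of the conditional probability of the event E given the
   sub-sigma-algebra G. *)
Record is_cond_prob (d : measure_display) (T : measurableType d) (R : realType)
    (P : probability T R) (G : set (set T)) (E : set T) (Z : T -> R) : Prop := {
  cond_prob_measurable : preimage_set_system setT Z measurable `<=` G ;
  cond_prob_integrable : P.-integrable setT (EFin \o Z) ;
  cond_prob_integral : forall A : set T, G A ->
    (\int[P]_(w in A) (Z w)%:E = P (E `&` A))%E }.

(* In everything below, sequences are indexed from 1 and their term of index 0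
   is never used: the index 0 is kept for "no balance" in [tau]. *)

(* sigma(X_1, Y_1, ..., X_(n-1), Y_(n-1), X_n) *)
Definition past (T : Type) (R : realType) (X Y : nat -> T -> R) (n : nat) :
    set (set T) :=
  <<s \bigcup_(j in [set j | (1 <= j <= n)%N])
        preimage_set_system setT (X j) measurable
      `|`
      \bigcup_(j in [set j | (1 <= j < n)%N])
        preimage_set_system setT (Y j) measurable >>.

Definition balanced (R : realType) (y : nat -> R) (n i : nat) : bool :=
  count (fun j => y j == -1) (index_iota i.+1 n.+1)
  == count (fun j => y j == 1) (index_iota i.+1 n.+1).

(* The maximum over an empty range is 0. *)
Definition tau (R : realType) (y : nat -> R) (n : nat) : nat :=
  \max_(1 <= i < n | balanced y n i) i.

Definition next_input (R : realType) (a b : R) (x y : nat -> R) (n : nat) : R :=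
  let t := tau y n in
  if (0 < t)%N then (x t + x n) / 2
  else if y n == 1 then (a + x n) / 2
  else (x n + b) / 2.

Record langlie (d : measure_display) (T : measurableType d) (R : realType)
    (P : probability T R) (F : R -> R) (a b : R)
    (X Y : nat -> {RV P >-> R}) : Prop := {
  langlie_outcome : forall n w, (1 <= n)%N -> Y n w = 1 \/ Y n w = -1 ;
  langlie_first : forall w, X 1%N w = (a + b) / 2 ;
  langlie_success : forall n, (1 <= n)%N ->
    is_cond_prob P (past X Y n) [set w | Y n w = 1] (fun w => F (X n w)) ;
  langlie_failure : forall n, (1 <= n)%N ->
    is_cond_prob P (past X Y n) [set w | Y n w = -1]
      (fun w => 1 - F (X n w)) ;
  langlie_next : forall n w, (1 <= n)%N ->
    X n.+1 w = next_input a b (fun j => X j w) (fun j => Y j w) n }.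

(* Main.v *)
Require Import Defs.
From HB Require Import structures.
From mathcomp Require Import all_boot all_order all_algebra.
From mathcomp Require Import all_classical all_reals all_analysis.
From mathcomp Require Import measurable_realfun lra zify.
Import Order.TTheory GRing.Theory Num.Theory.
Import numFieldNormedType.Exports.
Local Open Scope classical_set_scope.
Local Open Scope ring_scope.

(** Let xi be the quantile of level q, with a < xi < b.  If X_n converges to
    xi, then from some index on X_(n+1) is close to X_n, hence is neither
    (a + X_n) / 2 nor (X_n + b) / 2, since these tend to (a + xi) / 2 and
    (xi + b) / 2, both different from xi.  So eventually tau_n > 0
    ([cvg_tau_gt0]), which says that the walk S_n = Y_1 + ... + Y_n takes at
    time n a value that it already took at some earlier positive time.  Such a
    walk never leaves the finite range of its first N steps ([walk_bounded]),
    and a bounded walk with steps +1 and -1 contains no run of more than 2N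
    successes ([no_long_run]).

    Yet long runs of successes are bound to occur: since F(xi) = q, the
    success probability F(X_n) is eventually at least q / 2, so whatever the
    past, the next k trials all succeed with conditional probability at least
    (q / 2) ^ k.  Cutting time into disjoint blocks of length k, the probability
    that none of the first j blocks is a run of successes is at most
    (1 - (q / 2) ^ k) ^ j, which tends to 0 ([negligible_bounded_runs]).

    Convergence to xi is thus contained in a countable union, over the run
    length and the starting time, of events of probability 0. *)

(** * Long runs of successes in adapted sequences of trials *)

(** The condition [Q] is required only up to the first failure.  This makes the
    event decompose along the outcome of trial [n] alone, which is what the
    induction in [probability_failure_within] uses. *)
Fixpoint failure_within {T : Type} (Q U : nat -> set T) (n k : nat) : set T :=
  if k is k'.+1 then Q n `&` (~` U n `|` failure_within Q U n.+1 k') else set0.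

Fixpoint failure_in_blocks {T : Type} (Q U : nat -> set T) (n k j : nat) :
    set T :=
  if j is j'.+1 then
    failure_in_blocks Q U n k j' `&` failure_within Q U (n + j' * k) k
  else setT.

Lemma run_of_not_failure_within {T : Type} (Q U : nat -> set T) (n k : nat)
    (w : T) :
  (forall i, (n <= i)%N -> Q i w) -> ~ failure_within Q U n k w ->
  forall i, (i < k)%N -> U (n + i)%N w.
Proof.
elim: k n => [|k IH] n Qw //= nS [_|i].
  by rewrite addn0; apply: contrapT => nU; apply: nS; split; [exact: Qw|left].
rewrite ltnS addnS -addSn; apply: IH => [j nj|Sw].
  by apply: Qw; exact: ltnW.
by apply: nS; split; [exact: Qw|right].
Qed.

(** Trial [n] has success event [U n], known at time [n.+1]; [G n] is the
    information available just before it, and [Q n] is an event of [G n] on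
    which the conditional probability of success is at least [delta], as
    expressed by [success_ge]. *)
Section adapted_runs.
Context (d : measure_display) (T : measurableType d) (R : realType).
Context (P : probability T R) (G : nat -> set (set T)) (Q U : nat -> set T).
Context (delta : R).
Hypothesis sigmaG : forall n, sigma_algebra setT (G n).
Hypothesis filtG : forall n, G n `<=` G n.+1.
Hypothesis measG : forall n, G n `<=` measurable.
Hypothesis GQ : forall n, G n (Q n).
Hypothesis GU : forall n, G n.+1 (U n).
Hypothesis delta_gt0 : 0 < delta.
Hypothesis delta_lt1 : delta < 1.
Hypothesis success_ge : forall n A, G n A -> A `<=` Q n ->
  (delta%:E * P A <= P (A `&` U n))%E.

Let G_le {m n} : (m <= n)%N -> G m `<=` G n.
Proof.
move/subnK <-; elim: (n - m)%N => [|k IH] //.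
by apply: subset_trans IH _; rewrite addSn; exact: filtG.
Qed.

Let G_setI n A B : G n A -> G n B -> G n (A `&` B).
Proof.
have /sigma_algebraP[//|_ _ _] := sigmaG n; exact.
Qed.

Let G_setC n A : G n A -> G n (~` A).
Proof. by have [_ GC _] := sigmaG n => /GC; rewrite setTD. Qed.

Let G_setU n A B : G n A -> G n B -> G n (A `|` B).
Proof.
move=> GA GB; rewrite -[A `|` B]setCK setCU.
by apply/G_setC/G_setI; exact: G_setC.
Qed.

Let G_set0 n : G n set0.
Proof. by have [] := sigmaG n. Qed.

Lemma adapted_failure_within n k : G (n + k) (failure_within Q U n k).
Proof.
elim: k n => [|k IH] n /=; first exact: G_set0.
apply: G_setI; first by apply: (G_le _ _ (GQ n)); rewrite leq_addr.
apply: G_setU; last by rewrite addnS -addSn; exact: IH.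
by apply/G_setC/(G_le _ _ (GU n)); rewrite addnS ltnS leq_addr.
Qed.

(** Conditionally on [G n], a run of [k] successes has probability at least
    [delta ^+ k] as long as [Q] holds; integrating over an event [A] of [G n]
    avoids handling conditional probabilities.  With B the intersection of
    [A] and [Q n], the inductive step is
    P(B, failure) + (1 - delta^k) P(B, success)
      = P(B) - delta^k P(B, success) <= (1 - delta^(k+1)) P(B). *)
Lemma probability_failure_within n k A : G n A ->
  (P (A `&` failure_within Q U n k) <= (1 - delta ^+ k)%:E * P A)%E.
Proof.
elim: k n A => [|k IH] n A GA /=.
  by rewrite setI0 measure0 expr0 subrr mul0e.
set S := failure_within _ _ _ _.
have GB : G n (A `&` Q n) by exact: G_setI.
set B := A `&` Q n in GB.
have mB : measurable B by exact: measG GB.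
have mU : measurable (U n) by exact: measG (GU n).
have mA : measurable A by exact: measG GA.
have GBU : G n.+1 (B `&` U n) by apply: G_setI (GU n); exact: filtG.
have mBU : measurable (B `&` U n) by exact: measG GBU.
have mS : measurable S by exact: measG (adapted_failure_within n.+1 k).
have -> : A `&` (Q n `&` (~` U n `|` S)) = (B `\` U n) `|` (B `&` U n `&` S).
  rewrite /B; apply/seteqP; split => w /=; last tauto.
  by have [] := pselect (U n w); tauto.
have hU : (delta%:E * P B <= P (B `&` U n))%E.
  by apply: success_ge GB _; exact: subIsetr.
have hS := IH _ _ GBU; rewrite -/S in hS.
have hB : P B = (P (B `\` U n) + P (B `&` U n))%E by exact: measureDI.
have hBA : (P B <= P A)%E by rewrite le_measure ?inE//; exact: subIsetl.
have fin C : measurable C -> P C = (fine (P C))%:E.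
  by move=> mC; rewrite fineK// fin_num_measure.
have mD : measurable (B `\` U n) by exact: measurableD.
have mBS : measurable (B `&` U n `&` S) by exact: measurableI.
have hDS : P ((B `\` U n) `|` (B `&` U n `&` S)) =
    (P (B `\` U n) + P (B `&` U n `&` S))%E.
  apply: measureU => //.
  by apply/seteqP; split => w //= [[_ nU] [[_ Uw] _]].
have B0 : (0 <= P B)%E by [].
rewrite hDS.
move: hU hS hB hBA B0.
rewrite (fin _ mB) (fin _ mBU) (fin _ mA) (fin _ mD) (fin _ mBS).
rewrite -!EFinM -!EFinD !lee_fin => hU hS [hB] hBA B0.
have dk0 : 0 <= delta ^+ k by rewrite exprn_ge0 ?ltW.
have dk1 : delta ^+ k <= 1 by rewrite exprn_ile1 ?ltW.
have dS1 : delta ^+ k.+1 <= 1 by rewrite exprn_ile1 ?ltW.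
have h1 := ler_wpM2l dk0 hU.
have h2 : (1 - delta ^+ k.+1) * fine (P B) <= (1 - delta ^+ k.+1) * fine (P A).
  by apply: ler_wpM2l; lra.
apply: le_trans h2; rewrite exprS; lra.
Qed.

Lemma probability_failure_in_blocks n k j :
  G (n + j * k) (failure_in_blocks Q U n k j) /\
  (P (failure_in_blocks Q U n k j) <= ((1 - delta ^+ k) ^+ j)%:E)%E.
Proof.
elim: j => [|j [GB IH]] /=.
  split; last by rewrite expr0 probability_setT.
  by rewrite -setC0; apply: G_setC.
have dk1 : delta ^+ k <= 1 by rewrite exprn_ile1 ?ltW.
split; first rewrite mulSnr addnA.
  apply: G_setI; last exact: adapted_failure_within.
  by apply: (G_le _ _ GB); rewrite leq_addr.
apply: le_trans (probability_failure_within _ _ _ GB) _.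
by rewrite exprS EFinM lee_wpmul2l// lee_fin subr_ge0.
Qed.

(** A form of the conditional Borel-Cantelli lemma: almost surely, if [Q] holds
    from some time on, then runs of [k] successes occur after any time. *)
Lemma negligible_bounded_runs n k :
  P.-negligible (\bigcap_i failure_within Q U (n + i) k).
Proof.
have mC : measurable (\bigcap_i failure_within Q U (n + i) k).
  apply: bigcap_measurable => // i _.
  exact: measG (adapted_failure_within _ _).
apply/negligibleP => //; apply/eqP; rewrite eq_le measure_ge0 andbT.
have dk1 : delta ^+ k <= 1 by rewrite exprn_ile1 ?ltW.
have dk0 : 0 < delta ^+ k by rewrite exprn_gt0.
have cv : (((1 - delta ^+ k) ^+ j)%:E @[j --> \oo] --> 0%:E)%E.
  apply: cvg_EFin; first exact: nearW.
  by apply: cvg_expr; rewrite ger0_norm; lra.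
apply: (cvge_to_ge cv); apply: nearW => j.
apply: le_trans (proj2 (probability_failure_in_blocks n k j)).
rewrite le_measure ?inE//.
  exact: measG (proj1 (probability_failure_in_blocks n k j)).
elim: {+}j => [|i IH] // w Cw; split; first exact: IH.
exact: Cw.
Qed.

End adapted_runs.

(** * The walk of successes minus failures *)

Definition walk {R : realType} (y : nat -> R) (n : nat) : R :=
  \sum_(1 <= j < n.+1) y j.

Lemma sum_signs {R : realType} (y : nat -> R) (s : seq nat) :
  {in s, forall j, y j = 1 \/ y j = -1} ->
  \sum_(j <- s) y j =
    (count (fun j => y j == 1) s)%:R - (count (fun j => y j == -1) s)%:R.
Proof.
elim: s => [|j s IH] ys; first by rewrite big_nil subrr.
rewrite big_cons IH; last by move=> i si; apply: ys; rewrite inE si orbT.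
have n1 : (1 == -1 :> R) = false by apply/eqP; lra.
have n2 : (-1 == 1 :> R) = false by rewrite eq_sym.
rewrite /= !natrD.
by have [->|->] := ys j (mem_head _ _); rewrite eqxx ?n1 ?n2/=; lra.
Qed.

Lemma tau_gt0 {R : realType} (y : nat -> R) (n : nat) :
  (0 < tau y n)%N -> exists2 i, (1 <= i < n)%N & balanced y n i.
Proof.
move=> t0; apply: contrapT => nex; move: t0; rewrite /tau big_nat_cond big1 //.
by move=> i /andP[ni bi]; case: nex; exists i.
Qed.

Lemma walk_balanced {R : realType} (y : nat -> R) (n i : nat) :
  (forall j, (1 <= j)%N -> y j = 1 \/ y j = -1) -> (i <= n)%N ->
  balanced y n i -> walk y n = walk y i.
Proof.
move=> ys le_in /eqP bal; rewrite /walk (@big_cat_nat _ _ _ i.+1)//=.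
rewrite [X in _ + X]sum_signs ?bal ?subrr ?addr0// => j.
by rewrite mem_index_iota => /andP[ij _]; apply: ys; lia.
Qed.

(** Beyond time [N] the walk only revisits values, so by strong induction all its
    values are among those of the first [N] steps. *)
Lemma walk_bounded {R : realType} (y : nat -> R) (N : nat) :
  (forall j, (1 <= j)%N -> y j = 1 \/ y j = -1) ->
  (forall n, (N < n)%N -> (0 < tau y n)%N) ->
  forall n, `|walk y n| <= N%:R.
Proof.
move=> ys tau0; elim/ltn_ind => n IH.
have [nN|Nn] := leqP n N; last first.
  have [i /andP[_ lin] bal] := tau_gt0 _ _ (tau0 _ Nn).
  by rewrite (walk_balanced _ _ _ ys (ltnW lin) bal); exact: IH.
apply: (@le_trans _ _ n%:R); last by rewrite ler_nat.
apply: (le_trans (ler_norm_sum _ _ _)).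
rewrite big_nat (eq_bigr (fun=> 1)); last first.
  by move=> j /andP[j1 _]; have [->|->] := ys j j1; rewrite ?normrN normr1.
by rewrite -big_nat sumr_const_nat subn1.
Qed.

Lemma walk_run {R : realType} (y : nat -> R) (n k : nat) :
  (forall i, (i < k)%N -> y (n.+1 + i)%N = 1) ->
  walk y (n + k) = walk y n + k%:R.
Proof.
elim: k => [|k IH] run; first by rewrite addn0 addr0.
rewrite addnS {1}/walk big_nat_recr//= -/(walk y (n + k)) IH; last first.
  by move=> i ik; apply: run; exact: ltnW.
by rewrite -addSn run// -natr1 addrA.
Qed.

(** A run of [2 * N + 1] successes would climb by more than the width [2 * N] of
    the range of the walk. *)
Lemma no_long_run {R : realType} (y : nat -> R) (N : nat) :
  (forall j, (1 <= j)%N -> y j = 1 \/ y j = -1) ->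
  (forall n, (N < n)%N -> (0 < tau y n)%N) ->
  forall n, ~ (forall i, (i < (2 * N).+1)%N -> y (n.+1 + i)%N = 1).
Proof.
move=> ys tau0 n /walk_run e.
have := walk_bounded _ _ ys tau0 n.
have := walk_bounded _ _ ys tau0 (n + (2 * N).+1).
rewrite e -natr1 natrM !ler_norml; lra.
Qed.

(** * The convergence event *)

(** When [tau] vanishes, the next input is halfway to an endpoint, which is at a
    distance bounded below from the limit. *)
Lemma cvg_tau_gt0 {R : realType} (a b l : R) (x y : nat -> R) :
  a < l < b -> x n @[n --> \oo] --> l ->
  (forall n, (1 <= n)%N -> x n.+1 = next_input a b x y n) ->
  exists N, forall n, (N < n)%N -> (0 < tau y n)%N.
Proof.
move=> alb xl next; pose e := Num.min (l - a) (b - l) / 3.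
have e0 : 0 < e by rewrite divr_gt0// lt_min; lra.
have [ea eb] : 3 * e <= l - a /\ 3 * e <= b - l.
  by rewrite /e mulrC divfK//; split; rewrite ge_min lexx ?orbT.
have /cvgrPdist_lt/(_ e e0)[N _ xN] := xl.
exists N => n Nn; rewrite lt0n; apply/eqP => tau0.
(* If x_n and x_(n+1) are within e of l, then the endpoint 2 x_(n+1) - x_n is
   within 3 e of l: this is why e is a third of the distance to {a, b}. *)
have := xN n (ltnW Nn); have := xN n.+1 (leqW (ltnW Nn)).
rewrite next/=; last by case: n Nn {tau0}.
rewrite /next_input tau0 ltnn; case: ifP => _; rewrite !ltr_norml; lra.
Qed.

(** Being contained in a null event gives probability 0 only to a measurable
    set, as [P] need not be complete. *)
Lemma measurable_cvg_event (d : measure_display) (T : measurableType d)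
    (R : realType) (X : nat -> T -> R) (l : R) :
  (forall n, measurable_fun setT (X n)) ->
  measurable [set w | X n w @[n --> \oo] --> l].
Proof.
move=> mX.
have -> : [set w | X n w @[n --> \oo] --> l] =
    \bigcap_k \bigcup_N \bigcap_i X (N + i)%N @^-1` ball l k.+1%:R^-1.
  apply/seteqP; split => w /=.
    move=> /cvgrPdist_lt cv k _.
    have k0 : 0 < k.+1%:R^-1 :> R by rewrite invr_gt0.
    have [N _ xN] := cv _ k0.
    by exists N => // i _; exact: xN (leq_addr _ _).
  move=> cv; apply/cvgrPdist_lt => e e0.
  have [k ke] : exists k, k.+1%:R^-1 < e.
    have [k _ ke] := near_infty_natSinv_lt (PosNum e0).
    by exists k; exact: ke (leqnn _).
  have [N _ xN] := cv k I; exists N => // n /= /subnKC <-.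
  exact: lt_trans (xN (n - N)%N I) ke.
apply: bigcap_measurable => // k _; apply: bigcup_measurable => N _.
apply: bigcap_measurable => // i _.
by rewrite -[X in measurable X]setTI; apply: mX => //; exact: measurable_ball.
Qed.

Theorem theorem3p1 (d : measure_display) (T : measurableType d) (R : realType)
    (P : probability T R) (F : cumulativeBounded (0 : R) (1 : R))
    (hF : invertible01 F) (a b : R) (hab : a < b)
    (X Y : nat -> {RV P >-> R}) (hXY : langlie F a b X Y) :
  forall q : R, 0 < q < 1 -> a < quantile F q < b ->
    P [set w | X n w @[n --> \oo] --> quantile F q] = 0%E.
Proof.
move=> q q01 qab; set l := quantile F q in qab *.
have F_homo x y : x <= y -> F x <= F y by exact: cumulative_is_nondecreasing.
have Fl : F l = q.
  have [x [Fx _]] := hF q q01.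
  exact: (@xgetI _ 0 [set x | F x = q] x Fx).
(* Beyond c, which lies below l, the success probability is at least q / 2;
   c exists because F attains every level in (0, 1). *)
have [c [Fc _]] : exists! x, F x = q / 2 by apply: hF; lra.
have cl : c < l.
  by rewrite ltNge; apply/negP => /F_homo; rewrite Fl Fc; lra.
(* Trials of the procedure are numbered from 1, those of the section above
   from 0: trial n there is trial n.+1 here. *)
pose G n := past X Y n.+1.
pose Q n := [set w | q / 2 <= F (X n.+1 w)].
pose U n := [set w | Y n.+1 w = 1].
have sigmaG n : sigma_algebra setT (G n) by exact: smallest_sigma_algebra.
have measG n : G n `<=` measurable.
  apply: smallest_sub; first exact: sigma_algebra_measurable.
  by move=> A [|] [j _ [B mB <-]]; rewrite setTI; exact: measurable_funPTI.
have filtG n : G n `<=` G n.+1.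
  apply: sub_sigma_algebra2; apply: setUSS; apply: bigcup_subset => j /=; lia.
have GQ n : G n (Q n).
  apply: (cond_prob_measurable (langlie_success hXY (ltn0Sn n))).
  exists `[q / 2, +oo[%classic; first exact: measurable_itv.
  by rewrite setTI; apply/seteqP; split => w /=; rewrite in_itv/= andbT.
have GU n : G n.+1 (U n).
  apply: sub_sigma_algebra; right; exists n.+1 => /=; first lia.
  by exists [set 1]; rewrite ?setTI.
have success n A : G n A -> A `<=` Q n -> ((q / 2)%:E * P A <= P (A `&` U n))%E.
  move=> GA AQ; have mA := measG _ _ GA.
  have H := langlie_success hXY (ltn0Sn n).
  rewrite [A `&` _]setIC -(cond_prob_integral H GA) -integral_cst//.
  apply: le_integral => //.
  - exact: finite_measure_integrable_cst.
  - exact: integrableS (cond_prob_integrable H).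
  - by move=> w /[!inE] Aw; rewrite lee_fin; exact: AQ.
apply: measure_negligible; first by apply: measurable_cvg_event.
have null k m : P.-negligible (\bigcap_i failure_within Q U (m + i) k).
  by apply: (@negligible_bounded_runs _ _ _ P G Q U (q / 2)) => //; lra.
apply: (@negligibleS _ _ _ _
   (\bigcup_k \bigcup_m \bigcap_i failure_within Q U (m + i) k)); last first.
  by apply: negligible_bigcup => k; apply: negligible_bigcup => m.
move=> w /= cv.
have ys j : (1 <= j)%N -> Y j w = 1 \/ Y j w = -1.
  exact: langlie_outcome hXY j w.
have [N tauN] := cvg_tau_gt0 a b l (X ^~ w) (Y ^~ w) qab cv
  (fun n => @langlie_next _ _ _ _ _ _ _ _ _ hXY n w).
have [m _ Xm] : \forall n \near \oo, c < X n w by exact: cvgr_gt cv _ cl.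
exists (2 * N).+1 => //; exists m => // i _; apply: contrapT => nS.
apply: (no_long_run (Y ^~ w) _ ys tauN (m + i)%N) => j jk.
apply: (run_of_not_failure_within Q U _ _ _ _ nS _ jk) => n mn /=.
by rewrite /Q/= -Fc; apply/F_homo/ltW/Xm => /=; lia.
Qed.
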